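(* Let $p,q,r\in[0,1]$ with $p+q+r=1$ and $0<r<1$, let $s\in[0,1]$, and let $(S_n)$ be the elephant random walk with stops (ERWS) with parameters $p,q,r,s$. Assume the critical regime $\frac{p}{1-r}=\frac34$. Then $$\lim_{n\to\infty}\frac{S_n}{n}=0\qquad\text{almost surely}.$$
   Context: The elephant random walk with stops (ERWS) is defined as follows. The parameters are $p,q,r\in[0,1]$ with $p+q+r=1$, where $0<r<1$ is assumed throughout, and $s\in[0,1]$. The first step $X_1$ equals $+1$ with probability $s$ and $-1$ with probability $1-s$. For each $n\ge 1$, given $X_1,\dots,X_n$, an integer $k$ is chosen uniformly at random in $\{1,\dots,n\}$ and, independently of this choice and of the past, $X_{n+1}=X_k$ with probability $p$, $X_{n+1}=-X_k$ with probability $q$, and $X_{n+1}=0$ with probability $r$. The position of the ERWS is $S_0=0$ and $S_n=\sum_{k=1}^n X_k$ for $n\ge1$. *)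

(* Defs.v *)
From mathcomp Require Import all_boot all_order all_algebra.
From mathcomp Require Import all_classical all_reals all_analysis.
Import Order.TTheory GRing.Theory Num.Theory.
Import numFieldNormedType.Exports.

Set Implicit Arguments.
Unset Strict Implicit.
Unset Printing Implicit Defensive.

Local Open Scope classical_set_scope.
Local Open Scope ring_scope.

(* The sigma-algebra on T generated by X_1, ..., X_n. *)
Definition sigma_past d (T : measurableType d) (R : realType)
    (P : probability T R) (X : nat -> {RV P >-> R}) (n : nat) : set (set T) :=
  <<s [set E | exists2 k : nat, (1 <= k <= n)%N &
               exists2 B : set R, measurable B & E = X k @^-1` B] >>.

(* X_k is the k-th step for k >= 1. At time n >= 1 the walker recalls the time
   K_n in {1, ..., n}, and A_n in {1, -1, 0} tells whether the recalled step is
   repeated (probability p), reversed (q), or the walker stops (r), so that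
   X_{n+1} = A_n X_{K_n}. The variables X_0, K_0 and A_0 play no role.

   In erws_indep, C, D and E may be the full sets, so that the product rule for
   triples expresses the mutual independence of K_n, A_n and (X_1, ..., X_n). *)
Record is_erws d (T : measurableType d) (R : realType) (P : probability T R)
    (p q r s : R) (X : nat -> {RV P >-> R}) (K : nat -> {RV P >-> nat})
    (A : nat -> {RV P >-> R}) : Prop := IsERWS {
  erws_first_pos : P (X 1%N @^-1` [set 1]) = s%:E;
  erws_first_neg : P (X 1%N @^-1` [set -1]) = (1 - s)%:E;
  erws_memory_unif : forall n k : nat, (1 <= k <= n)%N ->
    P (K n @^-1` [set k]) = (n%:R^-1)%:E;
  erws_repeat : forall n : nat, (1 <= n)%N -> P (A n @^-1` [set 1]) = p%:E;
  erws_reverse : forall n : nat, (1 <= n)%N -> P (A n @^-1` [set -1]) = q%:E;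
  erws_stop : forall n : nat, (1 <= n)%N -> P (A n @^-1` [set 0]) = r%:E;
  erws_indep : forall (n : nat) (E : set T) (C : set nat) (D : set R),
    (1 <= n)%N -> sigma_past X n E -> measurable C -> measurable D ->
    P (E `&` K n @^-1` C `&` A n @^-1` D) =
      (P E * P (K n @^-1` C) * P (A n @^-1` D))%E;
  erws_step : forall n : nat, (1 <= n)%N ->
    {ae P, forall w, X n.+1 w = A n w * X (K n w) w} }.

Definition erws_position d (T : measurableType d) (R : realType)
    (P : probability T R) (X : nat -> {RV P >-> R}) (n : nat) (w : T) : R :=
  \sum_(1 <= k < n.+1) X k w.

(* Main.v *)
Require Import Defs.
From mathcomp Require Import all_boot all_order all_algebra.
From mathcomp Require Import ring lra zify.
From mathcomp Require Import all_classical all_reals all_analysis.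
From mathcomp Require Import measurable_realfun.
Import Order.TTheory GRing.Theory Num.Theory.
Import numFieldNormedType.Exports.
Local Open Scope classical_set_scope.
Local Open Scope ring_scope.

(** The second moment of the walk grows only linearly, and its steps are bounded;
    together these two facts force the strong law.

    Put a = p - q.  Given the past, the recalled step is uniform among
    X_1, ..., X_n and its multiplier has mean a, so
    E(X_(n+1) | past) = (a / n) S_n and, steps being bounded by 1,
    E S_(n+1)^2 <= (1 + 2 a / n) E S_n^2 + 1.
    When p / (1 - r) = 3/4 one has p = 3 q, hence a = (1 - r) / 2 < 1/2: the
    stops push the memory strictly below the threshold 1/2 of the elephant walk
    without stops.  The recursion is then dominated by the linear sequence
    n / (1 - 2 a) ([second_moment_linear], [second_moment_walk]).

    Along the squares, E (S_(n^2) / n^2)^2 = O(1 / n^2) is summable, so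
    S_(n^2) / n^2 tends to 0 almost surely.  Between n^2 and (n + 1)^2 the walk
    moves by at most 2 n, which is negligible against n^2; the whole sequence
    S_n / n therefore tends to 0 ([slln_of_second_moment]).

    Conditional expectations are avoided.  Almost surely every step and every
    multiplier lies in {1, -1, 0}, so each may be replaced everywhere by the
    difference of two indicators ([step_sign]).  Products of such variables are
    combinations of indicators of past events, to which the product rule of
    [erws_indep] applies directly; this gives
    E(X_j X_(n+1)) = (a / n) (E(X_j X_1) + ... + E(X_j X_n))
    ([step_correlation]), the only property of the memory that the recursion
    uses. *)

(** * Bounded random variables and almost sure events *)

Section probability_tools.
Context {d : measure_display} {T : measurableType d} {R : realType}.
Variable P : probability T R.
Implicit Types (f g : T -> R) (E F : set T).

Lemma probability1_ae E : measurable E -> P E = 1%E -> {ae P, forall w, E w}.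
Proof.
move=> mE PE; exists (~` E); split => //; first exact: measurableC.
by rewrite probability_setC// PE subee.
Qed.

(** Restating additivity for [P] seen as a probability keeps [P] in the form in
    which hypotheses about its values are written, so that they rewrite. *)
Lemma probabilityU E F : measurable E -> measurable F -> [disjoint E & F] ->
  P (E `|` F) = (P E + P F)%E.
Proof. by rewrite disj_set2E => mE mF /eqP; exact: measureU. Qed.

(** By monotone convergence the series of the [f n] has a finite integral, so it
    converges almost surely and its general term vanishes. *)
Lemma summable_integral_ae_cvg0 (f : nat -> T -> R) :
  (forall n, measurable_fun setT (f n)) -> (forall n w, 0 <= f n w) ->
  (\sum_(n <oo) \int[P]_w (f n w)%:E < +oo)%E ->
  {ae P, forall w, f n w @[n --> \oo] --> 0}.
Proof.
move=> mf f0 sumf.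
have mEf n : measurable_fun setT (EFin \o f n) by apply/measurable_EFinP.
have intS : P.-integrable setT (fun w => \sum_(n <oo) (f n w)%:E)%E.
  apply/integrableP; split.
    apply: (@ge0_emeasurable_sum _ _ _ _ (fun n w => (f n w)%:E) xpredT).
      by move=> n w _ _; rewrite lee_fin.
    by move=> n _; exact: mEf.
  under eq_integral => w _.
    rewrite gee0_abs; last by apply: nneseries_ge0 => n _ _; rewrite lee_fin.
    over.
  rewrite integral_nneseries// => n w _.
  by rewrite lee_fin.
apply: filterS (integrable_ae measurableT intS) => w /(_ I) finS.
apply: cvg_series_cvg_0; apply: nnseries_is_cvg => //.
by rewrite ltey_eq finS.
Qed.

(** Integrability is not stable under products; boundedness is, and it holds for
    every variable below. *)
Definition bounded_measurable f :=
  measurable_fun setT f /\ exists M : R, forall w, `|f w| <= M.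

Lemma bounded_measurable_integrable f :
  bounded_measurable f -> P.-integrable setT (EFin \o f).
Proof.
case=> mf [M fM]; apply: measurable_bounded_integrable => //.
  by rewrite [ltLHS](probability_setT P) ltry.
exists M; split; first exact: num_real.
by move=> N MN w _ /=; apply: le_trans (fM w) (ltW MN).
Qed.

Lemma bounded_measurable_indic E : measurable E -> bounded_measurable \1_E.
Proof.
move=> mE; split; first exact: measurable_indic.
by exists 1 => w; rewrite indicE; case: (_ \in _); rewrite ?normr1 ?normr0.
Qed.

Lemma bounded_measurable_cst (c : R) : bounded_measurable (fun=> c).
Proof. by split; [exact: measurable_cst | exists `|c|]. Qed.

Lemma bounded_measurableD f g : bounded_measurable f -> bounded_measurable g ->
  bounded_measurable (fun w => f w + g w).
Proof.
move=> [mf [M fM]] [mg [N gN]]; split; first exact: measurable_funD.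
by exists (M + N) => w; apply: le_trans (ler_normD _ _) (lerD _ _).
Qed.

Lemma bounded_measurableB f g : bounded_measurable f -> bounded_measurable g ->
  bounded_measurable (fun w => f w - g w).
Proof.
move=> [mf [M fM]] [mg [N gN]]; split; first exact: measurable_funB.
by exists (M + N) => w; apply: le_trans (ler_normB _ _) (lerD _ _).
Qed.

Lemma bounded_measurableM f g : bounded_measurable f -> bounded_measurable g ->
  bounded_measurable (fun w => f w * g w).
Proof.
move=> [mf [M fM]] [mg [N gN]]; split; first exact: measurable_funM.
by exists (M * N) => w; rewrite normrM ler_pM.
Qed.

Lemma bounded_measurable_sum (I : eqType) (s : seq I) (f : I -> T -> R) :
  (forall i, i \in s -> bounded_measurable (f i)) ->
  bounded_measurable (fun w => \sum_(i <- s) f i w).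
Proof.
elim: s => [|i s IH] fs.
  under eq_fun do rewrite big_nil.
  exact: bounded_measurable_cst.
under eq_fun do rewrite big_cons.
apply: bounded_measurableD; first by apply: fs; rewrite mem_head.
by apply: IH => j js; apply: fs; rewrite inE js orbT.
Qed.

Lemma Rintegral_sum (I : eqType) (s : seq I) (f : I -> T -> R) :
  (forall i, i \in s -> bounded_measurable (f i)) ->
  \int[P]_w (\sum_(i <- s) f i w) = \sum_(i <- s) \int[P]_w f i w.
Proof.
elim: s => [|i s IH] fs.
  by rewrite big_nil; under eq_Rintegral do rewrite big_nil;
     rewrite Rintegral_cst// mul0r.
have fs' j : j \in s -> bounded_measurable (f j).
  by move=> js; apply: fs; rewrite inE js orbT.
under eq_Rintegral do rewrite big_cons.
rewrite big_cons RintegralD//; first by rewrite IH.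
  by apply: bounded_measurable_integrable; apply: fs; rewrite mem_head.
exact/bounded_measurable_integrable/bounded_measurable_sum.
Qed.

Lemma ae_eq_Rintegral f g : measurable_fun setT f -> measurable_fun setT g ->
  {ae P, forall w, f w = g w} -> \int[P]_w f w = \int[P]_w g w.
Proof.
move=> mf mg fg; congr fine; apply: ae_eq_integral => //.
- exact/measurable_EFinP.
- exact/measurable_EFinP.
- by apply: filterS fg => w -> _.
Qed.

Lemma Rintegral_indic E : measurable E -> \int[P]_w \1_E w = fine (P E).
Proof. by move=> mE; congr fine; rewrite integral_indic// setIT. Qed.

End probability_tools.

(** * Strong law from a linear second moment *)

(** Each term 1 / k^2 is at most 2 / (k (k + 1)), which telescopes. *)
Lemma sum_inv_sqr_le (R : realType) (n : nat) :
  \sum_(0 <= k < n) (k.+1%:R ^+ 2)^-1 <= 2 - 2 / n.+1%:R :> R.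
Proof.
elim: n => [|n IH]; first by rewrite big_nil divr1 subrr.
rewrite big_nat_recr//=; apply: le_trans (lerD IH (lexx _)) _.
rewrite -subr_ge0.
have x1 : (1 : R) <= n.+1%:R by rewrite ler1n.
rewrite -(natr1 n.+1); set x : R := n.+1%:R in x1 *.
rewrite [X in 0 <= X](_ : _ = (x - 1) / (x ^+ 2 * (x + 1))).
  by rewrite divr_ge0 ?mulr_ge0 ?sqr_ge0//; lra.
by field; apply/andP; split; apply/eqP; lra.
Qed.

Lemma sqrt_bracket (m : nat) : exists n : nat, (n ^ 2 <= m < n.+1 ^ 2)%N.
Proof.
elim: m => [|m [n /andP[nm mn]]]; first by exists 0%N.
have [lt|ge] := ltnP m.+1 (n.+1 ^ 2); first by exists n; rewrite lt ltnW.
by exists n.+1; rewrite ge /=; nia.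
Qed.

Lemma partial_sum_lipschitz (R : realType) (y : nat -> R) (m n : nat) :
  (forall k, `|y k| <= 1) -> (m <= n)%N ->
  `|\sum_(1 <= k < n.+1) y k| <= `|\sum_(1 <= k < m.+1) y k| + (n - m)%:R.
Proof.
move=> y1 mn; rewrite (big_cat_nat (n := m.+1))//=.
apply: le_trans (ler_normD _ _) _; rewrite lerD2l.
apply: le_trans (ler_norm_sum _ _ _) _.
rewrite -subSS -[X in _ <= X]mulr1n -sumr_const_nat.
exact: ler_sum.
Qed.

(** Consecutive squares n^2 and (n + 1)^2 differ by O(n), so a sum with bounded
    increments cannot move by more than O(n) = o(n^2) between them. *)
Lemma cvg_mean_of_squares (R : realType) (y : nat -> R) :
  (forall k, `|y k| <= 1) ->
  (fun n => (\sum_(1 <= k < (n.+1 ^ 2).+1) y k) / (n.+1 ^ 2)%:R) @ \oo --> 0 ->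
  (fun n => (\sum_(1 <= k < n.+1) y k) / n%:R) @ \oo --> (0 : R).
Proof.
move=> y1 /cvgr0_norm_lt cvg_sq; apply/cvgr0Pnorm_lt => e e0.
have e2 : 0 < e / 2 by rewrite divr_gt0.
have [N _ smallN] := cvg_sq _ e2.
have [N' _ bigN'] := nbhs_infty_gtr (4 / e).
pose M := maxn N N'.
near=> m.
(* n^2 <= m < (n + 1)^2, and n exceeds both thresholds once m > (M + 2)^2 *)
have [n nm] := sqrt_bracket m.
have Mn : (M < n)%N.
  have : (M.+2 ^ 2 < m)%N by near: m; exact: nbhs_infty_gt.
  by nia.
case: n => // n in nm Mn *; rewrite ltnS in Mn.
case/andP: nm => nm mn.
have n0 : (0 : R) < n.+1%:R by rewrite ltr0n.
have m0 : (0 : R) < m%:R by rewrite ltr0n; nia.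
have /= sq_small :
    `|(\sum_(1 <= k < (n.+1 ^ 2).+1) y k) / (n.+1 ^ 2)%:R| < e / 2.
  by apply: smallN => /=; apply: leq_trans Mn; exact: leq_maxl.
have gap_small : 4 < e * n.+1%:R.
  rewrite -ltr_pdivrMl// mulrC; apply: bigN' => /=.
  by apply: leqW; apply: leq_trans Mn; exact: leq_maxr.
rewrite normrM normfV (ger0_norm (ltW m0)) ltr_pdivrMr//.
rewrite normrM normfV (@ger0_norm _ (n.+1 ^ 2)%:R)// in sq_small.
rewrite ltr_pdivrMr ?ltr0n// in sq_small.
apply: le_lt_trans (partial_sum_lipschitz _ _ _ _ y1 nm) _.
(* with N = n + 1: |S_m| < (e / 2) N^2 + 2 N, and 2 N < (e / 2) N^2 since
   4 < e N *)
have gapE : (m - n.+1 ^ 2)%:R <= 2 * n.+1%:R :> R.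
  by rewrite -natrM ler_nat; nia.
have sqm : (n.+1 ^ 2)%:R <= m%:R :> R by rewrite ler_nat.
rewrite natrX in sq_small sqm *.
nra.
Unshelve. all: by end_near.
Qed.

(** A second moment of order n bounds that of the mean by a multiple of 1 / n,
    which is summable along the squares; bounded increments fill the gaps. *)
Lemma slln_of_second_moment (d : measure_display) (T : measurableType d)
    (R : realType) (P : probability T R) (Y : nat -> T -> R) (C : R) :
  (forall k, measurable_fun setT (Y k)) -> (forall k w, `|Y k w| <= 1) ->
  (forall n, \int[P]_w (\sum_(1 <= k < n.+1) Y k w) ^+ 2 <= C * n%:R) ->
  {ae P, forall w, (fun n => (\sum_(1 <= k < n.+1) Y k w) / n%:R) @ \oo --> (0 : R)}.
Proof.
move=> mY Y1 second_moment.
pose f n w := ((\sum_(1 <= k < (n.+1 ^ 2).+1) Y k w) / (n.+1 ^ 2)%:R) ^+ 2.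
have bY k : bounded_measurable (Y k) by split; [|exists 1].
have bS n : bounded_measurable (fun w => (\sum_(1 <= k < n.+1) Y k w) ^+ 2).
  by apply: bounded_measurableM; apply: bounded_measurable_sum.
have mf n : measurable_fun setT (f n).
  apply: measurable_funX; apply: measurable_funM => //.
  exact: measurable_sum.
have C0 : 0 <= C.
  rewrite -[C]mulr1; apply: le_trans (second_moment 1%N).
  by apply: Rintegral_ge0 => w _; exact: sqr_ge0.
have int_f n : (\int[P]_w (f n w)%:E <= (C * (n.+1%:R ^+ 2)^-1)%:E)%E.
  have bf : bounded_measurable (f n).
    rewrite /f; under eq_fun do rewrite exprMn.
    apply: bounded_measurableM => //; exact: bounded_measurable_cst.
  rewrite -[leLHS]fineK; last first.
    exact/integrable_fin_num/bounded_measurable_integrable.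
  rewrite lee_fin -[leLHS]/(\int[P]_w f n w) /f.
  under eq_Rintegral do rewrite exprMn mulrC.
  rewrite RintegralZl//; last exact: bounded_measurable_integrable.
  set N := (n.+1 ^ 2)%N.
  have N0 : (0 : R) < N%:R by rewrite ltr0n.
  apply: le_trans (ler_wpM2l (sqr_ge0 _) (second_moment N)) _.
  rewrite -natrX -/N expr2 mulrCA -mulrA mulVf ?mulr1//.
  exact: lt0r_neq0.
have : {ae P, forall w, f n w @[n --> \oo] --> 0}.
  apply: summable_integral_ae_cvg0 => //; first by move=> *; exact: sqr_ge0.
  apply: (@le_lt_trans _ _ (C * 2)%:E); last exact: ltry.
  apply: lime_le.
    apply: is_cvg_nneseries => n _ _; apply: integral_ge0 => w _.
    by rewrite lee_fin sqr_ge0.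
  apply: nearW => n; apply: le_trans (lee_sum _ (fun k _ => int_f k)) _.
  rewrite sumEFin lee_fin -mulr_sumr ler_wpM2l//.
  apply: le_trans (sum_inv_sqr_le _ _) _.
  by rewrite gerBl divr_ge0.
apply: filterS => w cvg_f; apply: cvg_mean_of_squares => //.
apply/cvgr0Pnorm_lt => e e0.
have e2 : 0 < e ^+ 2 by rewrite exprn_gt0.
move/cvgr0_norm_lt: cvg_f => /(_ _ e2); apply: filterS => n.
by rewrite /f normrX ltr_pXn2r// nnegrE ltW.
Qed.

(** * Second moment of a walk that averages its past *)

(** The constant c = 1 / (1 - 2 a) solves c (n + 1) = (1 + 2 a / n) c n + 1
    exactly, so c n is the extremal solution; positivity of c is where
    2 a < 1 enters. *)
Lemma second_moment_linear (R : realFieldType) (a : R) (u : nat -> R) :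
  0 <= a -> 2 * a < 1 -> u 1%N <= 1 ->
  (forall n, (1 <= n)%N -> u n.+1 <= (1 + 2 * a / n%:R) * u n + 1) ->
  forall n, (1 <= n)%N -> u n <= (1 - 2 * a)^-1 * n%:R.
Proof.
move=> a0 a1 u1 uS; elim=> // -[|n] IH _.
  by rewrite mulr1; apply: le_trans u1 _; rewrite invf_ge1//; lra.
apply: le_trans (uS n.+1 isT) _.
have n0 : (0 : R) < n.+1%:R by rewrite ltr0n.
have k0 : 0 <= 1 + 2 * a / n.+1%:R by rewrite addr_ge0// divr_ge0 ?mulr_ge0// ltW.
apply: le_trans (lerD (ler_wpM2l k0 (IH isT)) (lexx 1)) _.
rewrite -[n.+2%:R]natr1 le_eqVlt; apply/orP; left; apply/eqP.
by field; rewrite !lt0r_neq0//; lra.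
Qed.

(** Summing the correlation hypothesis over [j] gives
    E(S_n Y_(n+1)) = (a / n) E S_n^2, the cross term in the expansion of
    (S_n + Y_(n+1))^2. *)
Lemma second_moment_walk (d : measure_display) (T : measurableType d)
    (R : realType) (P : probability T R) (Y : nat -> T -> R) (a : R) :
  (forall k, measurable_fun setT (Y k)) -> (forall k w, `|Y k w| <= 1) ->
  0 <= a -> 2 * a < 1 ->
  (forall n j, (1 <= j <= n)%N ->
    \int[P]_w (Y j w * Y n.+1 w) =
    a / n%:R * \sum_(1 <= k < n.+1) \int[P]_w (Y j w * Y k w)) ->
  forall n, \int[P]_w (\sum_(1 <= k < n.+1) Y k w) ^+ 2 <= (1 - 2 * a)^-1 * n%:R.
Proof.
move=> mY Y1 a0 a1 step n.
have bY k : bounded_measurable (Y k) by split; [|exists 1].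
have bYY j k : bounded_measurable (fun w => Y j w * Y k w).
  exact: bounded_measurableM.
have bS m : bounded_measurable (fun w => \sum_(1 <= k < m.+1) Y k w).
  exact: bounded_measurable_sum.
have intYY k : \int[P]_w Y k w ^+ 2 <= 1.
  rewrite -[leRHS](_ : \int[P]_w 1 = 1); last first.
    by rewrite Rintegral_cst// [X in fine X](probability_setT P) mulr1.
  apply: le_Rintegral => //.
    exact/bounded_measurable_integrable/bounded_measurableM.
    exact/bounded_measurable_integrable/bounded_measurable_cst.
  by move=> w _; rewrite -real_normK ?num_real// expr_le1.
case: n => [|n].
  under eq_Rintegral do rewrite big_nil expr0n /=.
  by rewrite Rintegral_cst// mul0r mulr0.
pose u m := \int[P]_w (\sum_(1 <= k < m.+1) Y k w) ^+ 2.
apply: (@second_moment_linear R a u) => //.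
  by rewrite /u; under eq_Rintegral do rewrite big_nat1.
move=> m m1; rewrite /u.
have cross : \int[P]_w ((\sum_(1 <= j < m.+1) Y j w) * Y m.+1 w) =
    a / m%:R * \int[P]_w (\sum_(1 <= k < m.+1) Y k w) ^+ 2.
  under eq_Rintegral do rewrite mulr_suml.
  rewrite Rintegral_sum//.
  under [X in _ = _ * X]eq_Rintegral do rewrite expr2 mulr_suml.
  rewrite Rintegral_sum; last by move=> j _; exact: bounded_measurableM.
  rewrite mulr_sumr; apply: eq_big_nat => j jm; rewrite step//.
  under [X in _ = _ * X]eq_Rintegral do rewrite mulr_sumr.
  by rewrite Rintegral_sum.
under eq_Rintegral do rewrite big_nat_recr//= sqrrD.
rewrite RintegralD//; last 2 first.
- apply: bounded_measurable_integrable; apply: bounded_measurableD.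
    by apply: bounded_measurableM.
  by apply: bounded_measurableD; apply: bounded_measurableM.
- by apply: bounded_measurable_integrable; apply: bounded_measurableM.
rewrite RintegralD//; last 2 first.
- by apply: bounded_measurable_integrable; apply: bounded_measurableM.
- apply: bounded_measurable_integrable.
  by apply: bounded_measurableD; apply: bounded_measurableM.
under [X in _ + X + _ <= _]eq_Rintegral do rewrite -mulr_natl.
rewrite RintegralZl//; last exact/bounded_measurable_integrable/bounded_measurableM.
rewrite cross.
by apply: lerD; rewrite ?mulrDl ?mul1r -?mulrA// intYY.
Qed.

(** * Correlations of the elephant walk with stops *)

(** This is everywhere bounded and a combination of events, whereas a step is
    known to lie in {1, -1, 0} only almost surely. *)
Definition step_sign (T : Type) (R : realType) (F : T -> R) (w : T) : R :=
  \1_(F @^-1` [set 1]) w - \1_(F @^-1` [set -1]) w.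

Arguments step_sign {T R}.

Definition is_step (R : realType) (x : R) := [\/ x = 1, x = -1 | x = 0].

Arguments is_step {R}.

Lemma mem_fiber (T : Type) (U : eqType) (F : T -> U) (x : U) (w : T) :
  (w \in F @^-1` [set x]) = (F w == x).
Proof. by apply/idP/eqP => [/set_mem|Fw]//; exact: mem_set. Qed.

Lemma step_signE (T : Type) (R : realType) (F : T -> R) (w : T) :
  is_step (F w) -> step_sign F w = F w.
Proof.
have N11 : (-1 == 1 :> R) = false by apply/eqP; lra.
rewrite /step_sign !indicE !mem_fiber => -[] ->.
- by rewrite eqxx (eq_sym 1) N11 subr0.
- by rewrite eqxx N11 sub0r.
- by rewrite !(eq_sym 0) oppr_eq0 oner_eq0 subrr.
Qed.

Lemma step_sign_le1 (T : Type) (R : realType) (F : T -> R) (w : T) :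
  `|step_sign F w| <= 1.
Proof.
rewrite /step_sign !indicE; case: (_ \in _); case: (_ \in _);
  by rewrite ?subrr ?subr0 ?sub0r ?normrN ?normr0 ?normr1.
Qed.

Lemma is_stepM (R : realType) (x y : R) :
  is_step x -> is_step y -> is_step (x * y).
Proof.
by move=> [] -> [] ->; rewrite ?mulr1 ?mulr0 ?mul0r ?mulrN1 ?opprK ?mul1r;
   [constructor 1 | constructor 2 | constructor 3 | constructor 2
   | constructor 1 | constructor 3 | constructor 3 | constructor 3
   | constructor 3].
Qed.

Section erws.
Context {d : measure_display} {T : measurableType d} {R : realType}.
Context {P : probability T R} {p q r s : R}.
Context {X : nat -> {RV P >-> R}} {K : nat -> {RV P >-> nat}}.
Context {A : nat -> {RV P >-> R}}.
Context (hpqr : p + q + r = 1) (hX : is_erws p q r s X K A).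

Let Y k := step_sign (X k).

Lemma measurable_preimage d' (U : measurableType d') (F : {RV P >-> U}) B :
  measurable B -> measurable (F @^-1` B).
Proof. by move=> mB; rewrite -[_ @^-1` _]setTI; exact: measurable_funP. Qed.

Lemma measurable_fiber (F : {RV P >-> R}) x : measurable (F @^-1` [set x]).
Proof. by apply: measurable_preimage; exact: measurable_set1. Qed.

Lemma measurable_fiber_nat (F : {RV P >-> nat}) k :
  measurable (F @^-1` [set k]).
Proof. exact: measurable_preimage. Qed.

Lemma bounded_measurable_step_sign (F : {RV P >-> R}) :
  bounded_measurable (step_sign F).
Proof.
by apply: bounded_measurableB; apply: bounded_measurable_indic;
   exact: measurable_fiber.
Qed.

Lemma fibers_disjoint (U : Type) (F : T -> U) x y : x <> y ->
  [disjoint F @^-1` [set x] & F @^-1` [set y]].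
Proof.
move=> xy; rewrite disj_set2E; apply/eqP.
by rewrite -subset0 => w [/= -> ].
Qed.

Lemma is_step1_ae : {ae P, forall w, is_step (X 1%N w)}.
Proof.
apply: filterS (probability1_ae P
  (X 1%N @^-1` [set 1] `|` X 1%N @^-1` [set -1]) _ _).
- by move=> w [] /= ->; [constructor 1 | constructor 2].
- by apply: measurableU; exact: measurable_fiber.
rewrite probabilityU; last 3 first.
- exact: measurable_fiber.
- exact: measurable_fiber.
- by apply: fibers_disjoint; lra.
by rewrite (erws_first_pos hX) (erws_first_neg hX) -EFinD; congr EFin; lra.
Qed.

Lemma multiplier_is_step_ae n : (1 <= n)%N -> {ae P, forall w, is_step (A n w)}.
Proof.
move=> n1.
have mA x := measurable_fiber (A n) x.
apply: filterS (probability1_ae P (A n @^-1` [set 1] `|` A n @^-1` [set -1]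
  `|` A n @^-1` [set 0]) _ _).
- by move=> w [[]|] /= ->; [constructor 1 | constructor 2 | constructor 3].
- by do ?apply: measurableU; exact: mA.
rewrite probabilityU//; last 2 first.
- exact: measurableU.
- rewrite disj_set2E setIUl; apply/eqP; rewrite setU_eq0.
  by split; apply/eqP; rewrite -disj_set2E; apply: fibers_disjoint; lra.
rewrite probabilityU//; last by apply: fibers_disjoint; lra.
rewrite (erws_repeat hX n1) (erws_reverse hX n1) (erws_stop hX n1) -!EFinD.
by congr EFin.
Qed.

Lemma memory_range_ae n : (1 <= n)%N -> {ae P, forall w, (1 <= K n w <= n)%N}.
Proof.
move=> n1.
pose F k := K n @^-1` [set k.+1].
have mF k : measurable (F k) by exact: measurable_fiber_nat.
apply: filterS (probability1_ae P (\big[setU/set0]_(k < n) F k) _ _).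
- by move=> w; rewrite -bigcup_mkord => -[k /= kn ->]; rewrite kn.
- exact: bigsetU_measurable.
have tF : trivIset setT F.
  by move=> i j _ _ [w [Ki Kj]]; move: Kj; rewrite /F /= Ki => -[].
transitivity (\sum_(k < n) P (F k))%E; first exact: measure_bigsetU.
rewrite (eq_bigr (fun=> (n%:R^-1)%:E)).
  rewrite sumEFin sumr_const card_ord; congr EFin.
  by rewrite -[LHS]mulr_natr mulVf// pnatr_eq0 -lt0n.
by move=> k _; apply: (erws_memory_unif hX) => /=.
Qed.

(** Off a null set, X_(n+1) is a product of a multiplier and of an earlier step,
    and {1, -1, 0} is closed under products. *)
Lemma is_step_ae : {ae P, forall w k, (1 <= k)%N -> is_step (X k w)}.
Proof.
have stepA : {ae P, forall w n, (1 <= n)%N -> is_step (A n w)}.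
  apply: ae_foralln => n; case: n => [|n]; first exact: aeW.
  by apply: filterS (multiplier_is_step_ae n.+1 isT) => w.
have rangeK : {ae P, forall w n, (1 <= n)%N -> (1 <= K n w <= n)%N}.
  apply: ae_foralln => n; case: n => [|n]; first exact: aeW.
  by apply: filterS (memory_range_ae n.+1 isT) => w.
have stepX : {ae P, forall w n, (1 <= n)%N -> X n.+1 w = A n w * X (K n w) w}.
  apply: ae_foralln => n; case: n => [|n]; first exact: aeW.
  by apply: filterS (erws_step hX (ltn0Sn n)) => w.
apply: filterS3 (filterI stepA rangeK) stepX is_step1_ae => w [wA wK] wX w1.
move=> k; elim/ltn_ind: k => -[|[|n]] IH // _.
rewrite wX//; apply: is_stepM; first exact: wA.
by have /andP[K1 Kn] := wK n.+1 isT; apply: IH.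
Qed.

Lemma step_sign_ae : {ae P, forall w k, (1 <= k)%N -> Y k w = X k w}.
Proof. by apply: filterS is_step_ae => w wX k k1; apply/step_signE/wX. Qed.

Lemma sigma_past_measurable n E : sigma_past X n E -> measurable E.
Proof.
apply: smallest_sub; first exact: sigma_algebra_measurable.
by move=> _ [k _ [B mB ->]]; exact: measurable_preimage.
Qed.

Lemma sigma_pastI n E F : sigma_past X n E -> sigma_past X n F ->
  sigma_past X n (E `&` F).
Proof. exact: (@measurableI _ (g_sigma_algebraType _)). Qed.

Lemma sigma_past_fiber n k x : (1 <= k <= n)%N ->
  sigma_past X n (X k @^-1` [set x]).
Proof.
by move=> kn; apply: sub_sigma_algebra; exists k => //; exists [set x].
Qed.

(** The weight with which the step at time [k] enters step [n.+1]; its mean is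
    (p - q) / n. *)
Let choice n k w := step_sign (A n) w * \1_(K n @^-1` [set k]) w.

Lemma bounded_measurable_choice n k : bounded_measurable (choice n k).
Proof.
apply: bounded_measurableM; first exact: bounded_measurable_step_sign.
exact/bounded_measurable_indic/measurable_fiber_nat.
Qed.

(** The expectation of [f] times the weight factorises. *)
Let uncorrelated n k (f : T -> R) := bounded_measurable f /\
  \int[P]_w (f w * choice n k w) = (p - q) / n%:R * \int[P]_w f w.

Lemma uncorrelatedB n k f g : uncorrelated n k f -> uncorrelated n k g ->
  uncorrelated n k (fun w => f w - g w).
Proof.
move=> [bf fE] [bg gE]; split; first exact: bounded_measurableB.
have bc := bounded_measurable_choice n k.
under eq_Rintegral do rewrite mulrBl.
rewrite !RintegralB// ?fE ?gE ?mulrBr//; apply: bounded_measurable_integrable => //;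
  exact: bounded_measurableM.
Qed.

(** For the indicator of a past event this is the product rule, applied once to
    each sign of the multiplier. *)
Lemma uncorrelated_past n k E : (1 <= k <= n)%N -> sigma_past X n E ->
  uncorrelated n k \1_E.
Proof.
move=> kn pE; have mE := sigma_past_measurable n E pE.
have n1 : (1 <= n)%N by case/andP: kn => /leq_trans; apply.
have mEK x : measurable (E `&` K n @^-1` [set k] `&` A n @^-1` [set x]).
  apply: measurableI; last exact: measurable_fiber.
  by apply: measurableI => //; exact: measurable_fiber_nat.
split; first exact: bounded_measurable_indic.
have indE x : \int[P]_w \1_(E `&` K n @^-1` [set k] `&` A n @^-1` [set x]) w =
    fine (P E) * n%:R^-1 * fine (P (A n @^-1` [set x])).
  rewrite Rintegral_indic// (erws_indep hX)//.
  have mA := measurable_fiber (A n) x.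
  rewrite (erws_memory_unif hX)// -[P E]fineK ?fin_num_measure//.
  by rewrite -[P (A n @^-1` _)]fineK ?fin_num_measure.
transitivity (\int[P]_w (\1_(E `&` K n @^-1` [set k] `&` A n @^-1` [set 1]) w -
    \1_(E `&` K n @^-1` [set k] `&` A n @^-1` [set -1]) w)).
  by apply: eq_Rintegral => w _; rewrite /choice /step_sign !indicI /=; ring.
rewrite RintegralB//; last 2 first.
- exact/bounded_measurable_integrable/bounded_measurable_indic.
- exact/bounded_measurable_integrable/bounded_measurable_indic.
rewrite !indE (erws_repeat hX)// (erws_reverse hX)// Rintegral_indic//=.
by ring.
Qed.

(** A product of two past steps is a signed sum of four indicators of past
    events, one for each pair of signs. *)
Lemma uncorrelated_steps n j k i : (1 <= j <= n)%N -> (1 <= k <= n)%N ->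
  (1 <= i <= n)%N -> uncorrelated n i (fun w => Y j w * Y k w).
Proof.
move=> jn kn iN.
pose E x y := X j @^-1` [set x] `&` X k @^-1` [set y].
have uE x y : uncorrelated n i \1_(E x y).
  by apply: uncorrelated_past => //; apply: sigma_pastI; exact: sigma_past_fiber.
rewrite [X in uncorrelated _ _ X](_ : _ = fun w =>
  (\1_(E 1 1) w - \1_(E 1 (-1)) w) - (\1_(E (-1) 1) w - \1_(E (-1) (-1)) w)).
  by do !apply: uncorrelatedB.
by apply/funext => w; rewrite /Y /step_sign /E !indicI /=; ring.
Qed.

(** Exactly one term of the sum survives, the one at the recalled time. *)
Lemma next_step_ae n : (1 <= n)%N ->
  {ae P, forall w, Y n.+1 w = \sum_(1 <= k < n.+1) Y k w * choice n k w}.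
Proof.
move=> n1.
apply: filterS3 (filterI step_sign_ae (multiplier_is_step_ae n n1))
  (memory_range_ae n n1) (erws_step hX n1) => w [wY wA] wK wX.
rewrite wY// wX (bigD1_seq (K n w)) ?mem_index_iota ?iota_uniq//=.
rewrite big1_seq ?addr0; last first.
  move=> k /andP[kK _].
  by rewrite /choice indicE mem_fiber eq_sym (negbTE kK) !mulr0.
case/andP: wK => K1 _.
by rewrite wY// /choice step_signE// indicE mem_fiber eqxx mulr1 mulrC.
Qed.

(** Conditioning on the recalled time: the weight of each past step factorises
    out of its product with [Y j]. *)
Lemma step_correlation n j : (1 <= j <= n)%N ->
  \int[P]_w (Y j w * Y n.+1 w) =
  (p - q) / n%:R * \sum_(1 <= k < n.+1) \int[P]_w (Y j w * Y k w).
Proof.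
move=> jn.
have n1 : (1 <= n)%N by case/andP: jn => /leq_trans; apply.
have bY k : bounded_measurable (Y k) := bounded_measurable_step_sign (X k).
have bc k : bounded_measurable (choice n k) := bounded_measurable_choice n k.
have bYYc k : bounded_measurable (fun w => Y j w * Y k w * choice n k w).
  by apply: bounded_measurableM => //; exact: bounded_measurableM.
transitivity (\int[P]_w \sum_(1 <= k < n.+1) (Y j w * Y k w * choice n k w)).
  apply: ae_eq_Rintegral.
  - by have [] : bounded_measurable (fun w => Y j w * Y n.+1 w) by
      exact: bounded_measurableM.
  - have [//] : bounded_measurable
      (fun w => \sum_(1 <= k < n.+1) (Y j w * Y k w * choice n k w)).
    exact: bounded_measurable_sum.
  - apply: filterS (next_step_ae n n1) => w ->.
    by rewrite mulr_sumr; apply: eq_bigr => k _; rewrite mulrA.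
rewrite Rintegral_sum// mulr_sumr; apply: eq_big_nat => k kn.
by have [_ ->] := uncorrelated_steps n j k k jn kn kn.
Qed.

End erws.

(** * The strong law at criticality *)

Theorem theorem3p4 (d : measure_display) (T : measurableType d) (R : realType)
    (P : probability T R) (p q r s : R)
    (X : nat -> {RV P >-> R}) (K : nat -> {RV P >-> nat})
    (A : nat -> {RV P >-> R})
    (hp : 0 <= p <= 1) (hq : 0 <= q <= 1) (hr : 0 < r < 1)
    (hpqr : p + q + r = 1) (hs : 0 <= s <= 1)
    (hX : is_erws p q r s X K A)
    (hcrit : p / (1 - r) = 3 / 4) :
  {ae P, forall w, (fun n : nat => erws_position X n w / n%:R) @ \oo --> (0 : R)}.
Proof.
have [r0 r1] : 0 < r /\ r < 1 by case/andP: hr.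
(* at criticality p = 3 q, so p - q = (1 - r) / 2 *)
have pE : p = 3 / 4 * (1 - r).
  by rewrite -hcrit -mulrA mulVf ?mulr1// subr_eq0 gt_eqF.
have drift0 : 0 <= p - q by lra.
have drift_lt : 2 * (p - q) < 1 by lra.
pose Y k := step_sign (X k).
have mY k : measurable_fun setT (Y k).
  by case: (bounded_measurable_step_sign (X k)).
have Y1 k w : `|Y k w| <= 1 by exact: step_sign_le1.
have slln := slln_of_second_moment d T R P Y _ mY Y1
  (second_moment_walk d T R P Y (p - q) mY Y1 drift0 drift_lt
    (step_correlation hpqr hX)).
apply: filterS2 (step_sign_ae hpqr hX) slln => w YX.
rewrite [X in _ -> X @ _ --> _](_ : _ =
  fun n => (\sum_(1 <= k < n.+1) Y k w) / n%:R)//.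
apply/funext => n; congr (_ / _).
by apply: eq_big_nat => k /andP[k1 _]; rewrite -YX.
Qed.
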